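(* Let $g,f\in\widehat{\mathcal G}_n\cap\mathcal G^z_n$. For $(t,z)\in[0,T)\times\mathbf R^{n\times d}$ and $\varepsilon\in[0,T-t]$, let $(y_s^{t+\varepsilon,z},z_s^{t+\varepsilon,z})$ and $(\tilde y_s^{t+\varepsilon,z},\tilde z_s^{t+\varepsilon,z})$ be the solutions, on $[0,t+\varepsilon]$, of the BSDE$(g,t+\varepsilon,z(B_{t+\varepsilon}-B_t))$ and of the BSDE$(f,t+\varepsilon,z(B_{t+\varepsilon}-B_t))$ given explicitly (with $h(s)=z1_{[t,t+\varepsilon]}(s)$) by $$y^{t+\varepsilon,z}_s=\int_s^{t+\varepsilon}g(r,h(r))dr+\int_0^sh(r)dB_r,\quad z^{t+\varepsilon,z}_s=h(s),$$ $$\tilde y^{t+\varepsilon,z}_s=\int_s^{t+\varepsilon}f(r,h(r))dr+\int_0^sh(r)dB_r,\quad \tilde z^{t+\varepsilon,z}_s=h(s),\qquad s\in[0,t+\varepsilon].$$ If for each $(t,z)\in[0,T)\times\mathbf R^{n\times d}$ and $\varepsilon\in[0,T-t]$ we have $y_t^{t+\varepsilon,z}\ge\tilde y_t^{t+\varepsilon,z}$, then for each $z\in\mathbf R^{n\times d}$, $g(t,z)\ge f(t,z)$ for a.e. $t\in[0,T)$.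
   Context: Let $(B_t)_{t\ge0}$ be a $d$-dimensional standard Brownian motion on a complete probability space $(\Omega,\mathcal F,P)$, with natural filtration $(\mathcal F_t)_{t\ge0}$ augmented by the $P$-null sets; $T>0$ is given. Inequalities between vectors of $\mathbf R^n$ are componentwise, and between random variables they hold almost surely. $\widehat{\mathcal G}_n\cap\mathcal G^z_n$: deterministic measurable functions $g(t,z):[0,T]\times\mathbf R^{n\times d}\to\mathbf R^n$ (generators independent of $y$) such that $\int_0^T|g(t,z)|dt<\infty$ for every $z\in\mathbf R^{n\times d}$. The BSDE$(g,r,\xi)$ is $Y_s=\xi+\int_s^rg(u,Z_u)du-\int_s^rZ_udB_u$, $s\in[0,r]$. *)

(* Defs.v *)
From mathcomp Require Import all_boot all_order all_algebra.
From mathcomp Require Import all_classical all_reals all_analysis.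

Set Implicit Arguments.
Unset Strict Implicit.
Unset Printing Implicit Defensive.

Import Order.TTheory GRing.Theory Num.Theory.
Import numFieldNormedType.Exports.

Local Open Scope classical_set_scope.
Local Open Scope ring_scope.

Definition sqnorm {R : realType} {m k : nat} (M : 'M[R]_(m, k)) : R :=
  \sum_i \sum_j M i j ^+ 2.

Definition vge {R : realType} {n : nat} (u v : 'cV[R]_n) : Prop :=
  forall i, v i ord0 <= u i ord0.

Definition vintegral {R : realType} {n : nat} (D : set R) (f : R -> 'cV[R]_n) :
    'cV[R]_n :=
  \col_i (\int[lebesgue_measure]_(u in D) f u i ord0)%R.

(* [0, T] x R^(n x d) carries the product of the Borel sigma-algebras. *)
Definition generator {R : realType} {n d : nat} (T : R)
    (g : R -> 'M[R]_(n, d) -> 'cV[R]_n) : Prop :=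
  (forall i, measurable_fun
     (`[0, T] `*` [set: g_sigma_algebraType (@open 'M[R]_(n, d))])
     (fun tz : R * g_sigma_algebraType (@open 'M[R]_(n, d)) =>
        g tz.1 tz.2 i ord0)) /\
  (forall z : 'M[R]_(n, d), (\int[lebesgue_measure]_(t in `[0%R, T])
                (Num.sqrt (sqnorm (g t z)))%:E < +oo)%E).

Section Brownian.
Context {R : realType} {disp : measure_display} {Omega : measurableType disp}.
Variable P : probability Omega R.

(* Processes are indexed by R; only their values at times t >= 0 matter. *)
Record brownian_motion {d : nat} (B : R -> Omega -> 'cV[R]_d) : Prop := {
  bm_measurable : forall t j, 0 <= t ->
    measurable_fun setT (fun w => B t w j ord0) ;
  bm_start : {ae P, forall w, B 0 w = 0} ;
  bm_continuous : {ae P, forall w, {within `[0, +oo[, continuous (B ^~ w)}} ;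
  bm_normal : forall s t j C, 0 <= s -> s < t -> measurable C ->
    P [set w | C (B t w j ord0 - B s w j ord0)]
    = normal_prob 0 (Num.sqrt (t - s)) C ;
  bm_independent : forall m (t : nat -> R) (C : 'I_m -> 'I_d -> set R),
    0 <= t 0%N -> (forall k, t k <= t k.+1) ->
    (forall k j, measurable (C k j)) ->
    P [set w | forall (k : 'I_m) (j : 'I_d),
         C k j (B (t k.+1) w j ord0 - B (t k) w j ord0)]
    = (\prod_(k < m) \prod_(j < d)
         fine (P [set w |
           C k j (B (t k.+1) w j ord0 - B (t k) w j ord0)]))%:E
}.

Variables (d : nat) (B : R -> Omega -> 'cV[R]_d).

Definition natural_filtration (t : R) : set (set Omega) :=
  <<s [set A | exists (s : R) (j : 'I_d) (C : set R),
         [/\ 0 <= s, s <= t, measurable C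
           & A = (fun w => B s w j ord0) @^-1` C]]
      `|` P.-negligible >>.

Definition measurable_at {m k : nat} (t : R) (X : Omega -> 'M[R]_(m, k)) :
    Prop :=
  forall i j, measurable_fun
    [set: g_sigma_algebraType (natural_filtration t)] (fun w => X w i j).

Definition adapted {m k : nat} (r : R) (X : R -> Omega -> 'M[R]_(m, k)) :
    Prop :=
  forall t, 0 <= t <= r -> measurable_at t (X t).

Definition progressive {m k : nat} (r : R) (X : R -> Omega -> 'M[R]_(m, k)) :
    Prop :=
  forall t, 0 <= t <= r -> forall i j, measurable_fun
    (`[0, t] `*` [set: g_sigma_algebraType (natural_filtration t)])
    (fun sw => X sw.1 sw.2 i j).

Definition continuous_paths {m k : nat} (r : R)
    (X : R -> Omega -> 'M[R]_(m, k)) : Prop :=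
  {ae P, forall w, {within `[0, r], continuous (X ^~ w)}}.

Definition sq_dist {m k : nat} (r : R) (X Y : R -> Omega -> 'M[R]_(m, k)) :
    \bar R :=
  (\int[P]_w \int[lebesgue_measure]_(s in `[0%R, r])
     (sqnorm (X s w - Y s w))%:E)%E.

Definition integrand {n : nat} (r : R) (Z : R -> Omega -> 'M[R]_(n, d)) :
    Prop :=
  progressive r Z /\ (sq_dist r Z (fun _ _ => 0%R) < +oo)%E.

(* The simple process equal to sp_coef k on ]sp_time k, sp_time k.+1],
   for k < sp_size. *)
Record simple_process (n : nat) := SimpleProcess {
  sp_size : nat ;
  sp_time : nat -> R ;
  sp_coef : nat -> Omega -> 'M[R]_(n, d)
}.

Definition simple_on {n : nat} (r : R) (S : simple_process n) : Prop :=
  [/\ 0 <= sp_time S 0%N, sp_time S (sp_size S) <= r,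
      (forall k, (k < sp_size S)%N -> sp_time S k <= sp_time S k.+1),
      (forall k, (k < sp_size S)%N ->
         measurable_at (sp_time S k) (sp_coef S k)) &
      (forall k, (k < sp_size S)%N -> exists K : R, forall w i j,
         `|sp_coef S k w i j| <= K)].

Definition simple_val {n : nat} (S : simple_process n) (s : R) (w : Omega) :
    'M[R]_(n, d) :=
  \sum_(k < sp_size S)
    (if sp_time S k < s <= sp_time S k.+1 then sp_coef S k w else 0).

Definition simple_integral {n : nat} (S : simple_process n) (s : R)
    (w : Omega) : 'cV[R]_n :=
  \sum_(k < sp_size S) sp_coef S k w *m
    (B (Num.min (sp_time S k.+1) s) w - B (Num.min (sp_time S k) s) w).

Definition is_ito_integral {n : nat} (r : R) (Z : R -> Omega -> 'M[R]_(n, d))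
    (I : R -> Omega -> 'cV[R]_n) : Prop :=
  [/\ adapted r I, continuous_paths r I &
      exists S : nat -> simple_process n,
        [/\ (forall k, simple_on r (S k)),
            sq_dist r Z (simple_val (S k)) @[k --> \oo] --> 0%E &
            forall s, 0 <= s <= r ->
              (\int[P]_w (sqnorm (I s w - simple_integral (S k) s w))%:E)%E
                @[k --> \oo] --> 0%E]].

(* A version of (\int_0^s Z dB)_(0 <= s <= r); the Ito integral of an integrand
   is only determined up to indistinguishability. *)
Definition ito_integral {n : nat} (r : R) (Z : R -> Omega -> 'M[R]_(n, d)) :
    R -> Omega -> 'cV[R]_n :=
  xget (fun _ _ => 0) [set I | is_ito_integral r Z I].

Record bsde_solution {n : nat} (g : R -> 'M[R]_(n, d) -> 'cV[R]_n) (r : R)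
    (xi : Omega -> 'cV[R]_n) (Y : R -> Omega -> 'cV[R]_n)
    (Z : R -> Omega -> 'M[R]_(n, d)) : Prop := {
  bsde_adapted : adapted r Y ;
  bsde_continuous : continuous_paths r Y ;
  bsde_integrand : integrand r Z ;
  bsde_integrable : {ae P, forall w, forall i,
    lebesgue_measure.-integrable `[0, r]
      (fun u => (g u (Z u w) i ord0)%:E)} ;
  bsde_equation : forall s, 0 <= s <= r -> {ae P, forall w,
    Y s w = xi w + vintegral `[s, r] (fun u => g u (Z u w))
            - (ito_integral r Z r w - ito_integral r Z s w)}
}.

Definition step {n : nat} (t eps : R) (z : 'M[R]_(n, d)) (s : R) :
    'M[R]_(n, d) :=
  if t <= s <= t + eps then z else 0.

Definition terminal {n : nat} (t eps : R) (z : 'M[R]_(n, d)) (w : Omega) :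
    'cV[R]_n :=
  z *m (B (t + eps) w - B t w).

Record explicit_solution {n : nat} (g : R -> 'M[R]_(n, d) -> 'cV[R]_n)
    (t eps : R) (z : 'M[R]_(n, d)) (Y : R -> Omega -> 'cV[R]_n)
    (Z : R -> Omega -> 'M[R]_(n, d)) : Prop := {
  explicit_bsde : bsde_solution g (t + eps) (terminal t eps z) Y Z ;
  explicit_Y : forall s, 0 <= s <= t + eps -> {ae P, forall w,
    Y s w = vintegral `[s, t + eps] (fun u => g u (step t eps z u))
            + ito_integral (t + eps) (fun u _ => step t eps z u) s w} ;
  explicit_Z : forall s, 0 <= s <= t + eps -> {ae P, forall w,
    Z s w = step t eps z s}
}.

End Brownian.

(* Main.v *)
(* At time t the two solutions share the same stochastic integral, so comparing
   them only compares the deterministic integrals of g(., z) and f(., z) over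
   [t, t + eps].  Hence h = g(., z) - f(., z) has nonnegative integral over every
   subinterval of [0, T], and dividing by eps -> 0+ gives h >= 0 at every
   point where the primitive of h has derivative h, thus almost everywhere by
   Lebesgue differentiation. *)
Require Import Defs.
From mathcomp Require Import all_boot all_order all_algebra.
From mathcomp Require Import all_classical all_reals all_analysis.
From mathcomp Require Import measurable_realfun.

Set Implicit Arguments.
Unset Strict Implicit.
Unset Printing Implicit Defensive.

Import Order.TTheory GRing.Theory Num.Theory.
Import numFieldNormedType.Exports.

Local Open Scope classical_set_scope.
Local Open Scope ring_scope.

Lemma ae_ge0_of_Rintegral_ge0 (R : realType) (a b : R) (h : R -> R) :
  lebesgue_measure.-integrable `[a, b] (EFin \o h) ->
  (forall x y, a <= x -> x <= y -> y <= b ->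
     0 <= \int[lebesgue_measure]_(u in `[x, y]) h u) ->
  {ae lebesgue_measure, forall t : R, a <= t < b -> 0 <= h t}.
Proof.
(* Extending [h] by zero gives a function integrable on the whole line, so its primitive from minus
   infinity is defined everywhere and [FTC1Ny] applies; on [[a, b]] nothing changes. *)
move=> ih hint; set k := h \_ `[a, b].
have ik : lebesgue_measure.-integrable setT (EFin \o k).
  have := (@integrable_mkcond _ _ _ lebesgue_measure _ (EFin \o h)
    (measurable_itv `[a, b])).1 ih.
  by rewrite restrict_EFin.
have ikS D : measurable D -> lebesgue_measure.-integrable D (EFin \o k).
  by move=> mD; apply: integrableS ik.
have := FTC1Ny (fun y => ikS _ (measurable_itv _))
  (integrable_locally (measurable_itv _) ih).
apply: filterS; first exact: (ae_filter_ringOfSetsType lebesgue_measure).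
move=> t [+ +] /andP[at_ tb].
rewrite -/k; set F := (fun x => _) => dF Ft.
have <- : k t = h t by rewrite /k patchE mem_set//= in_itv/= at_ ltW.
rewrite -Ft derive1E.
(* Such an increment of [F] is the integral of [h] over [[t, y]], a subinterval of [[a, b]]. *)
have incF y : t <= y -> y <= b -> F t <= F y.
  move=> ty yb; rewrite -subr_ge0 /F Rintegral_itvB//; last exact: ikS.
  rewrite Rintegral_itv_obnd_cbnd; last exact: ikS.
  suff -> : \int[lebesgue_measure]_(u in `[t, y]) k u =
      \int[lebesgue_measure]_(u in `[t, y]) h u by exact: hint.
  apply: eq_Rintegral => u; rewrite inE/= in_itv/= => /andP[tu uy].
  by rewrite /k patchE mem_set//= in_itv/= (le_trans at_ tu) (le_trans uy yb).
(* Increments are controlled only to the right of [t], so the derivative is read as a right limit;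
   [t < b] leaves room for small steps. *)
have dF' : h^-1 *: (F (h *: (1 : R) + t) - F t) @[h --> 0^'+] --> 'D_1 F t.
  exact: cvg_dnbhs_at_right dF.
rewrite -(cvg_lim _ dF')//; apply: limr_ge; first by apply/cvg_ex; eexists; exact: dF'.
near=> e.
have e0 : 0 < e by near: e; exact: nbhs_right_gt.
have eb : e < b - t by near: e; apply: nbhs_right_lt; rewrite subr_gt0.
rewrite [e *: 1]mulr1; apply: mulr_ge0; first by rewrite invr_ge0 ltW.
by rewrite subr_ge0 incF ?lerDr 1?ltW// -ltrBrDr.
Unshelve. all: by end_near. Qed.

(** Each component is dominated by the Euclidean norm, which is integrable for every fixed [z];
    measurability in [t] comes from joint measurability along the section at [z]. *)
Lemma generator_integrable (R : realType) (n d : nat) (T : R)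
    (g : R -> 'M[R]_(n, d) -> 'cV[R]_n) (z : 'M[R]_(n, d)) (i : 'I_n) :
  generator T g ->
  lebesgue_measure.-integrable `[0, T] (EFin \o (fun t => g t z i ord0)).
Proof.
move=> [mg ig].
have mgz j : measurable_fun `[0, T] (fun t => g t z j ord0).
  (* Retyping [z] as a point of the Borel space makes [pz] a measurable map into the product. *)
  pose zB : g_sigma_algebraType (@open 'M[R]_(n, d)) := z.
  pose G (tz : R * g_sigma_algebraType (@open 'M[R]_(n, d))) :=
    g tz.1 tz.2 j ord0.
  pose pz (t : R) := (t, zB).
  suff : measurable_fun `[0, T] (G \o pz) by [].
  apply: (measurable_comp (F := `[0, T] `*` setT)).
  - exact: measurableX.
  - by move=> _ [t tT <-].
  - exact: mg.
  - by apply: measurable_funTS; exact: pair2_measurable.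
have msq : measurable_fun `[0, T] (fun t => Num.sqrt (sqnorm (g t z))).
  apply: measurableT_comp.
    by apply: continuous_measurable_fun; exact: sqrt_continuous.
  rewrite /sqnorm; apply: measurable_sum => j; apply: measurable_sum => k.
  by rewrite ord1; apply: measurable_funX.
apply: (@le_integrable _ _ _ lebesgue_measure _
  (measurable_itv `[0, T]) _ (EFin \o (fun t => Num.sqrt (sqnorm (g t z))))).
- by apply/measurable_EFinP; exact: mgz.
- move=> t _; rewrite /= lee_fin [leRHS]ger0_norm ?sqrtr_ge0// -sqrtr_sqr ler_sqrt.
    rewrite /sqnorm (bigD1 i)//= big_ord1 lerDl sumr_ge0// => k _.
    by rewrite sumr_ge0// => l _; rewrite sqr_ge0.
  by rewrite sumr_ge0// => k _; rewrite sumr_ge0// => l _; rewrite sqr_ge0.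
- apply/integrableP; split; first exact/measurable_EFinP.
  under eq_integral do rewrite /= ger0_norm ?sqrtr_ge0//.
  exact: ig.
Qed.

Theorem proposition2p11 (R : realType) (disp : measure_display)
    (Omega : measurableType disp) (P : probability Omega R)
    (hP : measure_is_complete P) (n d : nat) (T : R) (hT : 0 < T)
    (B : R -> Omega -> 'cV[R]_d) (hB : brownian_motion P B)
    (g f : R -> 'M[R]_(n, d) -> 'cV[R]_n)
    (hg : generator T g) (hf : generator T f)
    (y ytilde : R -> 'M[R]_(n, d) -> R -> R -> Omega -> 'cV[R]_n)
    (zeta zetatilde : R -> 'M[R]_(n, d) -> R -> R -> Omega -> 'M[R]_(n, d))
    (hy : forall t z eps, 0 <= t < T -> 0 <= eps <= T - t ->
       explicit_solution P B g t eps z (y t z eps) (zeta t z eps))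
    (hytilde : forall t z eps, 0 <= t < T -> 0 <= eps <= T - t ->
       explicit_solution P B f t eps z (ytilde t z eps) (zetatilde t z eps))
    (hge : forall t z eps, 0 <= t < T -> 0 <= eps <= T - t ->
       {ae P, forall w, vge (y t z eps t w) (ytilde t z eps t w)}) :
  forall z : 'M[R]_(n, d),
    {ae lebesgue_measure, forall t : R, 0 <= t < T -> vge (g t z) (f t z)}.
Proof.
move=> z.
have ae_conclude i : {ae lebesgue_measure, forall t : R,
    0 <= t < T -> 0 <= g t z i ord0 - f t z i ord0}.
  have ig := generator_integrable z i hg.
  have jf := generator_integrable z i hf.
  apply: ae_ge0_of_Rintegral_ge0 => [|x y' x0].
    by apply: (integrableB _ ig jf); exact: measurable_itv.
  (* The degenerate interval is split off because the comparison requires a start time strictly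
     below [T], which follows from [x < y']. *)
  rewrite le_eqVlt => /predU1P[<- _|xy yT].
    by rewrite set_itv1 Rintegral_set1.
  have subT : `[x, y'] `<=` `[0, T] by apply: subset_itv; rewrite bnd_simp.
  have iS k : lebesgue_measure.-integrable `[0, T] k ->
      lebesgue_measure.-integrable `[x, y'] k by apply: integrableS.
  rewrite RintegralB ?subr_ge0//; [|exact: iS..].
  have xT : 0 <= x < T by rewrite x0 (lt_le_trans xy yT).
  have eT : 0 <= y' - x <= T - x by rewrite subr_ge0 ltW//= lerB.
  have xE : 0 <= x <= x + (y' - x) by rewrite x0 lerDl subr_ge0 ltW.
  (* Under a probability, an almost sure event is nonempty. One [w] satisfying both explicit
     formulas and the comparison suffices, as the resulting inequality is deterministic. *)
  have aeP : ProperFilter (almost_everywhere P).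
    apply: ae_properfilter_algebraOfSetsType.
    by rewrite [X in (_ < X)%E](probability_setT P).
  have [w [yE [ytE]]] : exists w, _ := filter_ex
    (filterI (explicit_Y (@hy _ z _ xT eT) xE)
    (filterI (explicit_Y (@hytilde _ z _ xT eT) xE) (@hge _ z _ xT eT))).
  (* Both formulas contain the same chosen version [ito_integral], with the same integrand and
     horizon, so it cancels exactly. *)
  rewrite yE ytE => /(_ i); rewrite !mxE lerD2r addrC subrK.
  set I1 := (X in X <= _ -> _); set I2 := (X in _ <= X -> _).
  suff [-> ->] : I1 = \int[lebesgue_measure]_(u in `[x, y']) f u z i ord0 /\
    I2 = \int[lebesgue_measure]_(u in `[x, y']) g u z i ord0 by [].
  (* With [eps = y' - x], [step] is constantly [z] on [[x, y']]. *)
  split; apply: eq_Rintegral => u; rewrite inE/= in_itv/= => uxy;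
    by rewrite /step addrC subrK uxy.
(* There are finitely many components, so their exceptional null sets merge into one. *)
have aeF := ae_filter_ringOfSetsType (@lebesgue_measure R).
apply: (@filterS _ _ aeF _ _ _ (filter_forall aeF ae_conclude)).
by move=> t ht tT i; rewrite -subr_ge0; exact: ht.
Qed.
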